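(* $n(3,6)=27$, $n(5,7)=74$, and $n(6,8)=150$.
   Context: A standard box in $\mathbb{R}^d$ is a set $K=K_1\times\cdots\times K_d$ where each $K_i\subseteq\mathbb{R}$ is a closed interval. A finite family of $d$-dimensional standard boxes in $\mathbb{R}^d$ is called $k$-neighborly if the dimension of the intersection of any two distinct members is in $\{d-k,d-k+1,\ldots,d-1\}$ (in particular the intersection is nonempty). For positive integers $1\le k\le d$, $n(k,d)$ is the maximum number of members of a $k$-neighborly family of $d$-dimensional standard boxes in $\mathbb{R}^d$. *)

(* Defs.v *)
From HB Require Import structures.
From mathcomp Require Import all_boot all_order all_algebra.
From mathcomp Require Import boolp classical_sets functions cardinality.
From mathcomp Require Import set_interval reals.

Set Implicit Arguments.
Unset Strict Implicit.
Unset Printing Implicit Defensive.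

Import Order.TTheory GRing.Theory Num.Theory.

Local Open Scope classical_set_scope.
Local Open Scope card_scope.
Local Open Scope ring_scope.

(* Nonempty and bounded, possibly reduced to a point. *)
Definition closed_interval (R : realType) (I : set R) : Prop :=
  exists a b : R, a <= b /\ I = `[a, b]%classic.

Definition standard_box (R : realType) (d : nat) (K : set 'rV[R]_d) : Prop :=
  exists I : 'I_d -> set R,
    (forall i, closed_interval (I i)) /\
    K = [set x | forall i, I i (x ord0 i)].

(* The affine hull of S is x + U, with U the least linear subspace containing
   S - x; the set S has dimension \dim U.  The empty set has no dimension. *)
Definition affine_dim (R : realType) (d : nat) (S : set 'rV[R]_d) (m : nat) :
    Prop :=
  exists x : 'rV[R]_d, S x /\
  exists U : {vspace 'rV[R]_d},
    [/\ \dim U = m,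
        forall y, S y -> y - x \in U &
        forall V : {vspace 'rV[R]_d},
          (forall y, S y -> y - x \in V) -> (U <= V)%VS].

Definition neighborly (R : realType) (k d : nat) (F : set (set 'rV[R]_d)) :
    Prop :=
  [/\ finite_set F,
      forall K, F K -> standard_box K /\ affine_dim K d &
      forall K L, F K -> F L -> K <> L ->
        exists2 m : nat, (d - k <= m <= d - 1)%N & affine_dim (K `&` L) m].

(* n(k, d) = N, for 1 <= k <= d. *)
Definition neighborly_number (R : realType) (k d N : nat) : Prop :=
  (exists2 F : set (set 'rV[R]_d), neighborly k F & F #= `I_N) /\
  (forall (F : set (set 'rV[R]_d)) (n : nat),
    neighborly k F -> F #= `I_n -> (n <= N)%N).

(* Main.v *)
(* Two full-dimensional boxes that meet lose a dimension in coordinate [i] exactly when an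
   endpoint is shared, so a [k]-neighborly family amounts to words over {0, 1, *} of length [d]
   that conflict (0 against 1) pairwise in at least 1 and at most [k] places.  Read such a word
   as a face of the cube; the faces are disjoint.  Spread a word with [s] stars as weight
   [2^-s] over the vertices of its face.  With [t = d - k], faces through antipodal vertices
   have at least [t] stars together, which bounds the weight of an antipodal pair; the bound
   is loosest when one of the two is a starless word, and then the other is in a face with
   [>= t] stars or uncovered.  On faces with [>= t] stars every character [chi S] with
   [#|S| > d - t] sums to 0.  So if [A] is the set of starless words, any imbalance
   [\sum_(x in A) chi S x] is paid for by uncovered or misplaced vertices.  For the word
   families that would be too large, [A] is so big a set of small diameter that this fails:
   by vertex isoperimetry for [(k, d)] = (6, 8) and (5, 7), by hand for (3, 6). *)

Require Import Defs.
From mathcomp Require Import all_boot all_order all_algebra.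
From mathcomp Require Import boolp zify.

Set Implicit Arguments.
Unset Strict Implicit.
Unset Printing Implicit Defensive.

Import Order.TTheory GRing.Theory Num.Theory.

(** * Vertex isoperimetry in the cube *)

Notation vertex d := {ffun 'I_d -> bool}.

Definition flip d (i : 'I_d) (x : vertex d) : vertex d :=
  [ffun j => (j == i) (+) x j].

Definition antipode d (x : vertex d) : vertex d := [ffun i => ~~ x i].

Definition parity d (S : {set 'I_d}) (x : vertex d) : bool :=
  \big[addb/false]_(i in S) x i.

Definition hdist d (x y : vertex d) : nat := #|[set i | x i != y i]|.

Definition parity_class d (A : {set vertex d}) (b : bool) : {set vertex d} :=
  [set x in A | parity setT x == b].

Definition half d (E : {set vertex d}) (i : 'I_d) (b : bool) : {set vertex d} :=
  [set x in E | x i == b].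

Definition flip_nbhd d (T : {set 'I_d}) (E : {set vertex d}) : {set vertex d} :=
  [set y | [exists i in T, flip i y \in E]].

Lemma flipK d (i : 'I_d) : involutive (flip i).
Proof. by move=> x; apply/ffunP=> j; rewrite !ffunE addKb. Qed.

Lemma antipodeK d : involutive (@antipode d).
Proof. by move=> x; apply/ffunP=> j; rewrite !ffunE negbK. Qed.

Lemma parity_flip d (S : {set 'I_d}) i (x : vertex d) :
  parity S (flip i x) = (i \in S) (+) parity S x.
Proof.
rewrite /parity; under eq_bigr do rewrite ffunE.
rewrite big_split /=.
suff -> : \big[addb/false]_(j in S) (j == i) = (i \in S) by [].
case: (boolP (i \in S)) => iS.
  by rewrite (bigD1 i) //= eqxx big1 // => j /andP[_ /negPf].
by rewrite big1 // => j jS; apply: contraNF iS => /eqP <-.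
Qed.

Lemma parity_antipode d (S : {set 'I_d}) (x : vertex d) :
  parity S (antipode x) = odd #|S| (+) parity S x.
Proof.
rewrite /parity; under eq_bigr do rewrite ffunE -addTb.
rewrite big_split /=.
suff -> : \big[addb/false]_(i in S) true = odd #|S| by [].
by rewrite big_const; elim: #|S| => //= n ->.
Qed.

Lemma parityT_setC1 d (i : 'I_d) (x : vertex d) :
  parity setT x = x i (+) parity [set~ i] x.
Proof.
rewrite /parity (bigD1 i) ?inE //=; congr addb.
by apply: eq_bigl => j; rewrite !inE.
Qed.

Lemma hdistE d (x y : vertex d) : hdist x y = \sum_i (x i != y i).
Proof.
rewrite /hdist -sum1_card big_mkcond /=.
by apply: eq_bigr => i _; rewrite inE; case: eqP.
Qed.

Lemma odd_hdist d (x y : vertex d) :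
  odd (hdist x y) = parity setT x (+) parity setT y.
Proof.
rewrite hdistE (big_morph _ oddD (erefl _)) /parity -big_split /=.
by apply: eq_big => [i | i _]; rewrite ?inE //; case: (x i) (y i) => [] [].
Qed.

Lemma hdist_antipode d (x y : vertex d) : hdist (antipode x) y = d - hdist x y.
Proof.
have -> : d - hdist x y = #|~: [set i | x i != y i]| by rewrite cardsCs setCK card_ord.
rewrite /hdist; congr #|pred_of_set _|; apply/setP=> i; rewrite !inE ffunE.
by case: (x i) (y i) => [] [].
Qed.

Lemma hdist_flip d i (x : vertex d) : hdist (flip i x) x = 1.
Proof.
rewrite -(cards1 i) /hdist; congr #|pred_of_set _|; apply/setP=> j.
by rewrite !inE ffunE; case: (j == i) (x j) => [] [].
Qed.

Lemma half_split d (E : {set vertex d}) i : #|E| = #|half E i false| + #|half E i true|.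
Proof.
rewrite -(cardsID [set x : vertex d | ~~ x i] E).
by congr (_ + _); apply: eq_card => x; rewrite !inE; case: (x i); rewrite ?andbT ?andbF.
Qed.

Lemma card_flip d i (E : {set vertex d}) : #|flip i @: E| = #|E|.
Proof. exact/card_imset/inv_inj/flipK. Qed.

(** Flipping a coordinate other than [i] stays in the half, and flipping [i] carries the opposite
    half injectively into it. *)
Lemma half_flip_nbhd d (T : {set 'I_d}) (E : {set vertex d}) i b : i \in T ->
  maxn #|flip_nbhd (T :\ i) (half E i b)| #|half E i (~~ b)|
    <= #|half (flip_nbhd T E) i b|.
Proof.
move=> iT; rewrite geq_max -(card_flip i (half E i (~~ b))).
apply/andP; split; apply/subset_leq_card/subsetP => x.
  rewrite !inE => /exists_inP[j]; rewrite !inE ffunE => /andP[ji jT] /andP[xE].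
  rewrite (eq_sym i j) (negPf ji) addFb => ->; rewrite andbT.
  by apply/exists_inP; exists j.
case/imsetP => y; rewrite !inE => /andP[yE /eqP yi] ->; rewrite ffunE eqxx yi /= negbK eqxx andbT.
by apply/exists_inP; exists i => //; rewrite flipK.
Qed.

Lemma card_flip_nbhd_half d (T : {set 'I_d}) (E : {set vertex d}) i : i \in T ->
  maxn #|flip_nbhd (T :\ i) (half E i false)| #|half E i true| +
  maxn #|flip_nbhd (T :\ i) (half E i true)| #|half E i false|
    <= #|flip_nbhd T E|.
Proof.
by move=> iT; rewrite (half_split (flip_nbhd T E) i) leq_add // half_flip_nbhd.
Qed.

(* [nth 0 (iso_table n) m] is a lower bound for the number of neighbours of [m] vertices of
   equal parity in the [n.+1]-cube (which has [2 ^ n] vertices of either parity): cut the cube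
   into two halves, with [p] and [m - p] of the vertices; the neighbours in one half contain
   both those of its own vertices and a copy of the vertices of the other half. *)
Fixpoint iso_table (n : nat) : seq nat :=
  if n is n'.+1 then
    let s := iso_table n' in
    let h := 2 ^ n' in
    [seq foldr minn (2 * h)
       [seq maxn (nth 0 s p) (m - p) + maxn (nth 0 s (m - p)) p
         | p <- iota 0 m.+1 & (p <= h) && (m - p <= h)]
      | m <- iota 0 (2 * h).+1]
  else [:: 0; 1].

Lemma foldr_minn_le z s x : x \in s -> foldr minn z s <= x.
Proof.
elim: s => //= y s IH; rewrite inE geq_min => /predU1P[-> | /IH ->].
  by rewrite leqnn.
by rewrite orbT.
Qed.

Lemma iso_table_le n p q : p <= 2 ^ n -> q <= 2 ^ n ->
  nth 0 (iso_table n.+1) (p + q) <=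
    maxn (nth 0 (iso_table n) p) q + maxn (nth 0 (iso_table n) q) p.
Proof.
move=> hp hq; have lt_pq : p + q < (2 * 2 ^ n).+1 by rewrite ltnS mul2n -addnn leq_add.
rewrite {1}/iso_table -/iso_table (nth_map 0) ?size_iota // nth_iota // add0n.
apply: foldr_minn_le; apply/mapP; exists p; last by rewrite addKn.
by rewrite mem_filter hp addKn hq mem_iota add0n ltnS leq_addr.
Qed.

(** Induction on the dimension of a subcube with free directions [T] that contains [E]. The size
    bound is carried along because the table minimises only over splits whose parts fit into the two
    halves. *)
Lemma iso_tableP d n (T : {set 'I_d}) (E : {set vertex d}) : #|T| = n.+1 ->
  {in E &, forall x y : vertex d, forall i, i \notin T -> x i = y i} ->
  {in E &, forall x y, parity setT x = parity setT y} ->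
  #|E| <= 2 ^ n /\ nth 0 (iso_table n) #|E| <= #|flip_nbhd T E|.
Proof.
elim: n T E => [|n IHn] T E cT ET Epar.
  have [i Ti] : exists i, T = [set i] by apply/cards1P; rewrite cT.
  have E1 : #|E| <= 1.
    apply/card_le1_eqP=> y x yE xE; apply/ffunP=> j.
    have eq_out k : k != i -> x k = y k by move=> ki; apply: ET; rewrite ?Ti ?inE.
    have [-> | ji] := eqVneq j i; last exact: eq_out.
    have := Epar x y xE yE; rewrite !(parityT_setC1 i).
    suff -> : parity [set~ i] x = parity [set~ i] y by move/addIb.
    by apply: eq_bigr => k; rewrite !inE => ki; apply: eq_out.
  split=> //; case: (set_0Vmem E) => [-> | [x xE]]; first by rewrite cards0.
  have -> : #|E| = 1 by apply/eqP; rewrite eqn_leq E1 card_gt0; apply/set0Pn; exists x.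
  rewrite card_gt0; apply/set0Pn; exists (flip i x).
  by rewrite inE; apply/exists_inP; exists i; rewrite ?flipK // Ti set11.
have [i iT] : exists i, i \in T by apply/set0Pn; rewrite -card_gt0 cT.
have cTi : #|T :\ i| = n.+1 by move: (cardsD1 i T); rewrite iT cT => -[].
have [//|//|le0 N0] := IHn (T :\ i) (half E i false) cTi.
- move=> x y; rewrite !inE => /andP[xE /eqP xi] /andP[yE /eqP yi] j.
  by rewrite !inE negb_and negbK => /predU1P[->| jT]; [rewrite xi yi | apply: ET].
- by move=> x y; rewrite !inE => /andP[xE _] /andP[yE _]; apply: Epar.
have [//|//|le1 N1] := IHn (T :\ i) (half E i true) cTi.
- move=> x y; rewrite !inE => /andP[xE /eqP xi] /andP[yE /eqP yi] j.
  by rewrite !inE negb_and negbK => /predU1P[->| jT]; [rewrite xi yi | apply: ET].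
- by move=> x y; rewrite !inE => /andP[xE _] /andP[yE _]; apply: Epar.
rewrite (half_split E i); split; first by rewrite expnS mul2n -addnn leq_add.
apply: leq_trans (iso_table_le le0 le1) _.
apply: leq_trans (card_flip_nbhd_half E iT).
by rewrite leq_add // geq_max !leq_max ?N0 ?N1 leqnn ?orbT.
Qed.

Lemma card_same_parity d (E : {set vertex d.+1}) :
  {in E &, forall x y, parity setT x = parity setT y} -> #|E| <= 2 ^ d.
Proof.
move=> Epar; have [] // := @iso_tableP d.+1 d setT E _ _ Epar.
- by rewrite cardsT card_ord.
- by move=> x y _ _ i; rewrite inE.
Qed.

Lemma parity_class_same d (A : {set vertex d}) b :
  {in parity_class A b &, forall x y, parity setT x = parity setT y}.
Proof. by move=> x y; rewrite !inE => /andP[_ /eqP ->] /andP[_ /eqP ->]. Qed.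

(** The antipode of a neighbour of [x] is at distance [d] from [x], too far to lie in [A] when [x]
    does. So the antipodes of the neighbourhood and the other summand are disjoint, and both lie in
    one parity class of the cube. *)
Lemma card_anticode_nbhd d (A : {set vertex d.+1}) b :
  {in A &, forall x y, hdist x y + 2 <= d.+1} ->
  #|flip_nbhd setT (parity_class A b)| + #|parity_class A (b (+) odd d)| <= 2 ^ d.
Proof.
move=> Adist; set N := flip_nbhd _ _.
have cN : #|@antipode d.+1 @: N| = #|N| by apply/card_imset/inv_inj/antipodeK.
rewrite -cN -cardsUI.
have -> : @antipode d.+1 @: N :&: parity_class A (b (+) odd d) = set0.
  apply/setP=> x; rewrite in_set0; apply/negP; rewrite inE => /andP[/imsetP[y]].
  rewrite inE => /exists_inP[i _]; rewrite inE => /andP[iyA _] ->.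
  rewrite inE => /andP[yA _]; have := Adist _ _ yA iyA.
  rewrite hdist_antipode.
  have -> : hdist y (flip i y) = 1 by rewrite -(hdist_flip i (flip i y)) flipK.
  lia.
rewrite cards0 addn0; apply: card_same_parity.
suff par x : x \in @antipode d.+1 @: N :|: parity_class A (b (+) odd d) ->
    parity setT x = b (+) odd d.
  by move=> x y /par -> /par ->.
rewrite inE => /orP[/imsetP[y] |]; last by rewrite inE => /andP[_ /eqP].
rewrite inE => /exists_inP[i _]; rewrite inE => /andP[_].
rewrite parity_flip inE => /eqP <- ->.
by rewrite parity_antipode cardsT card_ord /=; case: (odd d) (parity _ _) => [] [].
Qed.

Lemma iso_table_parity_class d (A : {set vertex d.+1}) b :
  nth 0 (iso_table d) #|parity_class A b| <= #|flip_nbhd setT (parity_class A b)|.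
Proof.
have [] // := @iso_tableP d.+1 d setT (parity_class A b).
- by rewrite cardsT card_ord.
- by move=> x y _ _ i; rewrite inE.
- exact: parity_class_same.
Qed.

(** Two parity classes of size at least 46 would give [83 + 46 > 2 ^ 7] in [card_anticode_nbhd]. *)
Lemma iso_table7 m : 46 <= m <= 128 -> 82 < nth 0 (iso_table 7) m.
Proof.
have tab : all (fun m => 82 < nth 0 (iso_table 7) m) (iota 46 83) by vm_compute.
by move=> ?; apply: (allP tab); rewrite mem_iota.
Qed.

Lemma anticode8 (A : {set vertex 8}) :
  {in A &, forall x y, hdist x y + 2 <= 8} ->
  #|parity_class A false| <= 45 \/ #|parity_class A true| <= 45.
Proof.
move=> Adist; have := card_anticode_nbhd false Adist.
have := iso_table_parity_class A false; set N := flip_nbhd _ _.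
set e := #|_| => Ne; rewrite (_ : _ (+) _ = true) // => No.
have [|e46] := leqP e 45; first by left.
have [|o46] := leqP #|parity_class A true| 45; first by right.
have e128 : e <= 128 by exact/card_same_parity/parity_class_same.
have /leq_trans/(_ Ne) N83 : 82 < nth 0 (iso_table 7) e by apply: iso_table7; rewrite e46.
clear Ne; move: No; rewrite (_ : 2 ^ 7 = 128) //; lia.
Qed.

(** * Large sets of small diameter *)

(** A median of [E]: it minimises the total Hamming distance to [E]. *)
Definition majority d (E : {set vertex d}) : vertex d :=
  [ffun i => #|half E i false| < #|half E i true|].

Lemma sum_hdist d (E : {set vertex d}) (c : vertex d) :
  \sum_(x in E) hdist x c = \sum_i #|half E i (~~ c i)|.
Proof.
under eq_bigr do rewrite hdistE.
rewrite exchange_big /=; apply: eq_bigr => i _.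
rewrite -sum1_card big_mkcond [RHS]big_mkcond /=; apply: eq_bigr => x _.
by rewrite inE; case: (x \in E); case: (x i) (c i) => [] [].
Qed.

Lemma half_majority d (E : {set vertex d}) i m :
  (#|half E i false| <= m) || (#|half E i true| <= m) ->
  #|half E i (~~ majority E i)| <= m.
Proof. by rewrite ffunE; case: ltnP => /=; lia. Qed.

Lemma sum_hdist_majority d (E : {set vertex d}) m :
  (forall i, (#|half E i false| <= m) || (#|half E i true| <= m)) ->
  \sum_(x in E) hdist x (majority E) <= d * m.
Proof.
move=> Em; rewrite sum_hdist -[X in X * m]card_ord -sum_nat_const.
by apply: leq_sum => i _; apply: half_majority.
Qed.

Lemma hdist1P d (x c : vertex d) : hdist x c = 1 -> exists i, x = flip i c.
Proof.
move/eqP/cards1P => [i /setP Di]; exists i; apply/ffunP=> j.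
by have := Di j; rewrite !inE ffunE; case: (j == i) (x j) (c j) => [] [] [].
Qed.

Lemma card_sphere1 d (c : vertex d) : #|[set x | hdist x c == 1]| <= d.
Proof.
rewrite -[leqRHS]card_ord -cardsT.
apply: leq_trans (leq_imset_card (fun i => flip i c) _).
apply/subset_leq_card/subsetP => x; rewrite inE => /eqP/hdist1P[i ->].
by apply/imsetP; exists i; rewrite ?inE.
Qed.

(** An odd distance is at least 3 unless it is 1, which happens for at most [d] vertices, each
    falling short by 2. *)
Lemma sum_hdist_opposite d (E : {set vertex d}) (c : vertex d) :
  {in E, forall x, odd (hdist x c)} ->
  3 * #|E| <= \sum_(x in E) hdist x c + 2 * d.
Proof.
move=> Eodd; apply: (@leq_trans (\sum_(x in E) (hdist x c + 2 * (hdist x c == 1)))).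
  have -> : 3 * #|E| = \sum_(x in E) 3 by rewrite sum_nat_const mulnC.
  apply: leq_sum => x /Eodd.
  by case: (hdist x c) => [|[|[|n]]] //= _; lia.
rewrite big_split leq_add2l /= -big_distrr leq_mul2l /=.
apply: leq_trans (card_sphere1 c); rewrite -sum1_card [leqRHS]big_mkcond [leqLHS]big_mkcond /=.
by apply: leq_sum => x _; rewrite inE; case: (x \in E); case: (_ == _).
Qed.

(** In odd dimension the two summands of [card_anticode_nbhd] come from the same class, so this caps
    a class at 22. *)
Lemma iso_table6 m : 23 <= m <= 64 -> 64 < nth 0 (iso_table 6) m + m.
Proof.
have tab : all (fun m => 64 < nth 0 (iso_table 6) m + m) (iota 23 42) by vm_compute.
by move=> ?; apply: (allP tab); rewrite mem_iota.
Qed.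

(** A class of 22 leaves room for [64 - 22 = 42] neighbours; a cut into [m] and [22 - m] vertices
    with both parts at least 8 produces more. *)
Lemma iso_table5 m : 8 <= m <= 14 ->
  42 < maxn (nth 0 (iso_table 5) m) (22 - m) + maxn (nth 0 (iso_table 5) (22 - m)) m.
Proof.
have tab : all (fun m => let s := iso_table 5 in
    42 < maxn (nth 0 s m) (22 - m) + maxn (nth 0 s (22 - m)) m) (iota 8 7) by vm_compute.
by move=> ?; apply: (allP tab); rewrite mem_iota.
Qed.

Lemma anticode7_class (A : {set vertex 7}) b :
  {in A &, forall x y, hdist x y + 2 <= 7} -> #|parity_class A b| <= 22.
Proof.
move=> Adist; have := card_anticode_nbhd b Adist.
have := iso_table_parity_class A b; rewrite (_ : b (+) odd 6 = b) ?addbF //.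
set e := #|parity_class A b| => Ne No; have [//|e23] := leqP e 22.
have e64 : e <= 64 by exact/card_same_parity/parity_class_same.
have e64' : 23 <= e <= 64 by rewrite e23.
have := leq_trans (iso_table6 e64') (leq_add Ne (leqnn e)).
clear Ne; move: No; rewrite (_ : 2 ^ 6 = 64) //; lia.
Qed.

Lemma anticode7_half (A : {set vertex 7}) b i :
  {in A &, forall x y, hdist x y + 2 <= 7} -> #|parity_class A b| = 22 ->
  (#|half (parity_class A b) i false| <= 7) || (#|half (parity_class A b) i true| <= 7).
Proof.
move=> Adist E22; have := card_anticode_nbhd b Adist.
rewrite (_ : b (+) odd 6 = b) ?addbF //.
have := card_flip_nbhd_half (parity_class A b) (in_setT i).
have par c : {in half (parity_class A b) i c &,
    forall x y, parity setT x = parity setT y}.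
  by move=> x y /[!inE] /andP[/andP[_ /eqP ->] _] /andP[/andP[_ /eqP ->] _].
have agree c : {in half (parity_class A b) i c &, forall x y : vertex 7,
    forall j, j \notin setT :\ i -> x j = y j}.
  move=> x y /[!inE] /andP[_ /eqP xi] /andP[_ /eqP yi] j.
  by rewrite !inE andbT negbK => /eqP ->; rewrite xi yi.
have cT : #|setT :\ i| = 6 by rewrite setTD cardsCs setCK card_ord cards1.
have [_ N0] := iso_tableP cT (agree false) (par false).
have [_ N1] := iso_tableP cT (agree true) (par true).
move: N0 N1; rewrite (half_split _ i) in E22 *; move: E22.
set p := #|half _ i false|; set q := #|half _ i true| => pq N0 N1 N22 N42.
have [//|p8] := leqP p 7; have [//|q8] := leqP q 7.
have p814 : 8 <= p <= 14 by clear N0 N1; lia.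
have q22 : 22 - p = q by clear N0 N1; lia.
move: (iso_table5 p814); rewrite q22.
move: N0 N1; set a := nth 0 _ p; set c := nth 0 _ q => N0 N1.
move: (leq_trans (leq_add N22 (leqnn _)) N42); rewrite (_ : 2 ^ 6 = 64) //.
set u := #|flip_nbhd _ (half _ _ false)|; set v := #|flip_nbhd _ (half _ _ true)|.
rewrite -/u -/v in N0 N1 *; clearbody a c; lia.
Qed.

Lemma parity_class_split d (A : {set vertex d}) :
  #|A| = #|parity_class A false| + #|parity_class A true|.
Proof.
rewrite -(cardsID [set x : vertex d | ~~ parity setT x] A).
by congr (_ + _); apply: eq_card => x; rewrite !inE; case: (parity _ x); rewrite ?andbT ?andbF.
Qed.

(* If the two parity classes were cut alike by all coordinates they would have the same majority
   vector [c], at total distance at most [7 * 7] from each of them; but the 22 vertices whose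
   parity is opposite to that of [c] have total distance at least [7 * 1 + 15 * 3] to [c]. *)
Lemma anticode7 (A : {set vertex 7}) :
  {in A &, forall x y, hdist x y + 2 <= 7} -> 44 <= #|A| ->
  [/\ #|parity_class A false| = 22, #|parity_class A true| = 22 &
    exists i, #|half (parity_class A false) i false| <> #|half (parity_class A true) i false|].
Proof.
move=> Adist; rewrite parity_class_split => A44.
have E22 : #|parity_class A false| = 22.
  by move: (anticode7_class false Adist) (anticode7_class true Adist); lia.
have O22 : #|parity_class A true| = 22.
  by move: (anticode7_class false Adist) (anticode7_class true Adist); lia.
split=> //; apply: contrapT => /forallNP eqEO.
have {}eqEO i b : #|half (parity_class A b) i false| = #|half (parity_class A false) i false|.
  by case: b => //; symmetry; apply: contrapT; apply: eqEO.
have eqEO' i b : #|half (parity_class A b) i true| = #|half (parity_class A false) i true|.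
  have := half_split (parity_class A b) i; have := half_split (parity_class A false) i.
  by rewrite eqEO; case: b; lia.
have majE b : majority (parity_class A b) = majority (parity_class A false).
  by apply/ffunP=> i; rewrite !ffunE eqEO eqEO'.
set c := majority (parity_class A false) in majE.
pose b := ~~ parity setT c.
have Ab22 : #|parity_class A b| = 22 by case: b.
have := @sum_hdist_majority 7 (parity_class A b) 7 (fun i => anticode7_half i Adist Ab22).
have := @sum_hdist_opposite 7 (parity_class A b) c.
rewrite majE Ab22 => H1 H2.
have {}/H1 : {in parity_class A b, forall x, odd (hdist x c)}.
  by move=> x /[!inE] /andP[_ /eqP px]; rewrite odd_hdist px /b; case: parity.
lia.
Qed.

(** Distances within [E] are even, hence at most 2. A vertex of the opposite half differs from [u]
    in [i] and one further place, which must be one of the at most two places where [u] and [v]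
    differ. *)
Lemma half_le2 d (E : {set vertex d}) i b u v :
  {in E &, forall x y, parity setT x = parity setT y} ->
  {in E &, forall x y, hdist x y <= 3} ->
  u \in half E i b -> v \in half E i b -> u != v -> #|half E i (~~ b)| <= 2.
Proof.
move=> Epar Edist uE vE uv.
have dist2 x y : x \in E -> y \in E -> hdist x y <= 2.
  move=> xE yE; have := Edist x y xE yE; rewrite leq_eqVlt => /predU1P[xy3 | //].
  by have := odd_hdist x y; rewrite (Epar x y xE yE) addbb xy3.
have flip2 x y : x \in half E i (~~ b) -> y \in half E i b ->
    exists2 j, j != i & x = flip i (flip j y).
  rewrite !inE => /andP[xE /eqP xi] /andP[yE /eqP yi].
  have xy_i : x i != y i by rewrite xi yi; case: (b).
  have xy2 : hdist x y = 2.
    have := odd_hdist x y; rewrite (Epar x y xE yE) addbb.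
    have : 0 < hdist x y by rewrite card_gt0; apply/set0Pn; exists i; rewrite inE.
    by move: (dist2 x y xE yE); case: (hdist x y) => [|[|[|n]]].
  have /cards1P[j /setP Dj] : #|[set k | x k != y k] :\ i| == 1.
    have := cardsD1 i [set k | x k != y k]; rewrite -/(hdist x y) xy2 inE xy_i.
    by rewrite add1n => -[<-].
  have ji : j != i by have := Dj j; rewrite !inE eqxx => /andP[].
  exists j => //; apply/ffunP=> k; have := Dj k; rewrite !inE !ffunE.
  have [-> _ | ki] /= := eqVneq k i; first by rewrite eq_sym (negPf ji) xi yi; case: (b).
  by case: (k == j) (x k) (y k) => [] [] [].
have uvE : u \in E /\ v \in E by move: uE vE; rewrite !inE => /andP[-> _] /andP[-> _].
apply: leq_trans (dist2 u v uvE.1 uvE.2).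
apply: leq_trans (leq_imset_card (fun j => flip i (flip j u)) _).
apply/subset_leq_card/subsetP => x xE.
have [j ji xu] := flip2 x u xE uE; have [k ki xv] := flip2 x v xE vE.
apply/imsetP; exists j => //; rewrite inE; apply: contra_neq uv => uvj.
have /ffunP eq_uv : flip j u = flip k v by apply: (can_inj (flipK i)); rewrite -xu -xv.
have jk : j = k.
  by have := eq_uv j; rewrite !ffunE eqxx uvj; case: eqP => // _; case: (v j).
by move/ffunP: eq_uv; rewrite jk => /(can_inj (flipK k)).
Qed.

Lemma half_le1 d (E : {set vertex d}) :
  {in E &, forall x y, parity setT x = parity setT y} ->
  {in E &, forall x y, hdist x y <= 3} -> 5 <= #|E| ->
  forall i, (#|half E i false| <= 1) || (#|half E i true| <= 1).
Proof.
move=> Epar Edist E5 i; apply/negbNE; rewrite negb_or -!ltnNge.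
apply/negP => /andP[/card_gt1P[u [v [uE vE uv]]] /card_gt1P[x [y [xE yE xy]]]].
have := half_le2 Epar Edist uE vE uv; have := half_le2 Epar Edist xE yE xy.
by move: E5; rewrite (half_split E i) /=; lia.
Qed.

(** Each of the 6 coordinates adds at most 1 to the total distance from the majority vector. Were
    its parity [b], the other members would be at distance at least 2, so [E] would have at most 4
    elements; otherwise every distance is at least 1. *)
Lemma majority_opposite (E : {set vertex 6}) b :
  {in E, forall x, parity setT x = b} ->
  {in E &, forall x y, hdist x y <= 3} -> 5 <= #|E| ->
  #|E| <= 6 /\ parity setT (majority E) = ~~ b.
Proof.
move=> Epar Edist E5.
have Epar2 : {in E &, forall x y, parity setT x = parity setT y}.
  by move=> x y /Epar -> /Epar ->.
have := sum_hdist_majority (half_le1 Epar2 Edist E5); rewrite muln1.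
set c := majority E => sum6.
have [pc | pc] := eqVneq (parity setT c) b.
  have : 2 * #|E :\ c| <= 6.
    have -> : 2 * #|E :\ c| = \sum_(x in E :\ c) 2 by rewrite sum_nat_const mulnC.
    apply: leq_trans sum6; rewrite [leqRHS](bigID (mem (E :\ c))) /=.
    apply: leq_trans (leq_addr _ _); rewrite [leqLHS]big_mkcond [leqRHS]big_mkcond /=.
    apply: leq_sum => x _; rewrite !inE; have [-> // | xc] := eqVneq x c.
    case: (boolP (x \in E)) => //= xE.
    have : hdist x c != 0.
      rewrite cards_eq0; apply: contra xc => /eqP/setP D0; apply/eqP/ffunP => i.
      by have := D0 i; rewrite !inE => /negbFE/eqP.
    have := odd_hdist x c; rewrite (Epar x xE) pc addbb.
    by case: (hdist x c) => [|[|n]].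
  move: E5; rewrite (cardsD1 c E); set m := #|E :\ c| => E5 m6; exfalso.
  by clearbody m; case: (c \in E) E5; rewrite ?add1n ?add0n; lia.
have {}pc : parity setT c = ~~ b by move: pc; case: (parity _ _) (b) => [] [].
split=> //; apply: leq_trans sum6; rewrite -sum1_card; apply: leq_sum => x xE.
by have := odd_hdist x c; rewrite (Epar x xE) pc; case: (hdist x c) (b) => [|n] [].
Qed.

(** The majority vectors of the two classes have opposite parities, so they differ in some
    coordinate [i], where the classes lean to opposite sides. *)
Lemma anticode6 (A : {set vertex 6}) :
  {in A &, forall x y, hdist x y + 3 <= 6} -> 11 <= #|A| ->
  [/\ 5 <= #|parity_class A false| <= 6, 5 <= #|parity_class A true| <= 6 &
    exists i b, #|half (parity_class A false) i b| <= 1 /\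
                #|half (parity_class A true) i (~~ b)| <= 1].
Proof.
move=> Adist; rewrite parity_class_split => A11.
have Edist b : {in parity_class A b &, forall x y, hdist x y <= 3}.
  by move=> x y /[!inE] /andP[xA _] /andP[yA _]; have := Adist x y xA yA; lia.
have Epar b : {in parity_class A b, forall x, parity setT x = b}.
  by move=> x /[!inE] /andP[_ /eqP].
have E6 b : #|parity_class A b| <= 6.
  by case: (leqP 5 #|parity_class A b|) => [/(majority_opposite (Epar b) (Edist b))[] | ]; lia.
have E5 b : 5 <= #|parity_class A b| by case: b; move: (E6 false) (E6 true); lia.
split; rewrite ?E5 ?E6 //.
have [_ pE] := majority_opposite (Epar false) (Edist false) (E5 false).
have [_ pO] := majority_opposite (Epar true) (Edist true) (E5 true).
have /eqP : majority (parity_class A false) != majority (parity_class A true).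
  by apply: contraTneq pE => ->; rewrite pO.
have le1 b i : #|half (parity_class A b) i (~~ majority (parity_class A b) i)| <= 1.
  apply: half_majority; apply: half_le1 => //.
  exact: parity_class_same.
case: (pickP (fun i => majority (parity_class A false) i != majority (parity_class A true) i)).
  move=> i ci _; exists i, (~~ majority (parity_class A false) i); split=> //.
  have -> : ~~ ~~ majority (parity_class A false) i = ~~ majority (parity_class A true) i.
    by move: ci; case: (majority _ i) (majority _ i) => [] [].
  exact: le1.
by move=> eqc []; apply/ffunP => i; apply/eqP/negbFE; apply: eqc.
Qed.

(** * Words and faces *)

Notation word d := {ffun 'I_d -> option bool}.

Definition conflict (a b : option bool) : bool :=
  if (a, b) is (Some x, Some y) then x != y else false.

Definition wdist d (u v : word d) : nat := #|[set i | conflict (u i) (v i)]|.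

Definition stars d (w : word d) : {set 'I_d} := [set i | w i == None].

Definition face d (w : word d) : {set vertex d} :=
  [set x : vertex d | [forall i, (w i == None) || (w i == Some (x i))]].

Definition chi d (S : {set 'I_d}) (x : vertex d) : int := ((-1) ^+ parity S x)%R.

Lemma face_wdist0 d (u v : word d) x : x \in face u -> x \in face v -> wdist u v = 0.
Proof.
rewrite !inE => /forallP xu /forallP xv; apply/eqP; rewrite cards_eq0; apply/eqP/setP=> i.
rewrite !inE; have := xu i; have := xv i.
by case: (u i) (v i) => [a|] [b|] //= /eqP[->] /eqP[->]; case: (x i).
Qed.

(** In a coordinate where neither word has a star, they carry the opposite letters of [x] and its
    antipode. *)
Lemma face_antipode d (u v : word d) x : x \in face u -> antipode x \in face v ->
  d <= wdist u v + (#|stars u| + #|stars v|).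
Proof.
rewrite !inE => /forallP xu /forallP xv.
rewrite -[leqLHS]card_ord -cardsT.
have -> : [set: 'I_d] = [set i | conflict (u i) (v i)] :|: (stars u :|: stars v).
  apply/setP=> i; rewrite !inE; have := xu i; have := xv i; rewrite ffunE.
  by case: (u i) (v i) => [a|] [b|] //= /eqP[->] /eqP[->]; case: (x i).
by rewrite (leq_trans (leq_card_setU _ _)) // leq_add2l leq_card_setU.
Qed.

Lemma card_face d (w : word d) : #|face w| = 2 ^ #|stars w|.
Proof.
pose F i : pred bool := fun b => (w i == None) || (w i == Some b).
have -> : #|face w| = #|family F|.
  by apply: eq_card => x; rewrite inE; apply: eq_forallb.
rewrite card_family foldrE big_image /=.
have -> : 2 ^ #|stars w| = \prod_(i in stars w) 2 by rewrite prod_nat_const.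
rewrite [RHS]big_mkcond /=; apply: eq_bigr => i _; rewrite inE /F.
case: (w i) => [b|] /=; last by rewrite -card_bool; apply: eq_card.
by rewrite -(card1 b); apply: eq_card => c; rewrite !inE eq_sym.
Qed.

Lemma face_flip d (w : word d) i x : i \in stars w -> (flip i x \in face w) = (x \in face w).
Proof.
rewrite !inE => /eqP wi; apply: eq_forallb => j; rewrite ffunE.
by have [-> | //] := eqVneq j i; rewrite wi.
Qed.

(** Flipping a starred coordinate in [S] permutes the face and negates [chi S]. *)
Lemma sum_chi_face d (S : {set 'I_d}) (w : word d) : S :&: stars w != set0 ->
  (\sum_(x in face w) chi S x = 0)%R.
Proof.
case/set0Pn=> i /setIP[iS iw].
have flip_neg : (\sum_(x in face w) chi S x = - \sum_(x in face w) chi S x)%R.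
  rewrite [LHS](reindex_inj (inv_inj (flipK i))) -sumrN /=.
  apply: eq_big => x; first exact: face_flip.
  by rewrite /chi parity_flip iS; case: (parity S x).
lia.
Qed.

Lemma hdist_face d (u v : word d) x y : stars u = set0 -> stars v = set0 ->
  x \in face u -> y \in face v -> hdist x y = wdist u v.
Proof.
move=> /setP u0 /setP v0; rewrite !inE => /forallP xu /forallP yv.
apply: eq_card => i; rewrite !inE; have := u0 i; have := v0 i; have := xu i; have := yv i.
by rewrite !inE; case: (u i) (v i) => [a|] [b|] //= /eqP[->] /eqP[->].
Qed.

(* [o1] and [o2] are the numbers of stars of the faces through two antipodal vertices, [None]
   for an uncovered vertex.  All weights are scaled by [2 ^ t], and those of faces with more
   than [t] stars are rounded up to those of [t] stars. *)
Lemma weight_pair (t : nat) (o1 o2 : option nat) : t \in [:: 2; 3] ->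
  (forall s1 s2, o1 = Some s1 -> o2 = Some s2 -> t <= s1 + s2) ->
  oapp (fun s => 2 ^ (t - s)) 0 o1 + oapp (fun s => 2 ^ (t - s)) 0 o2 +
    ((oapp (eq_op 0) false o2 (+) oapp (leq t) false o1) +
     (oapp (eq_op 0) false o1 (+) oapp (leq t) false o2))
  <= (2 ^ t.-1 + 2) +
     (2 ^ t.-1).-1 * (oapp (eq_op 0) false o1 + oapp (eq_op 0) false o2).
Proof.
rewrite !inE => /pred2P[] -> H.
  by case: o1 o2 H => [[|[|s]]|] [[|[|s']]|] // /(_ _ _ erefl erefl).
by case: o1 o2 H => [[|[|[|s]]]|] [[|[|[|s']]]|] // /(_ _ _ erefl erefl).
Qed.

Lemma sum_antipode d (f : vertex d -> nat) : \sum_x f (antipode x) = \sum_x f x.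
Proof. by rewrite [RHS](reindex_inj (inv_inj (@antipodeK d))). Qed.

(** The antipodal map changes [chi S] by a global sign only. After reflecting [P], subtracting the
    zero sum over [Q] leaves terms of absolute value 1 on the symmetric difference. *)
Lemma absz_sum_chi d (S : {set 'I_d}) (P Q : pred (vertex d)) :
  (\sum_(x | Q x) chi S x = 0)%R ->
  absz (\sum_(x | P x) chi S x)%R <= \sum_x (P (antipode x) (+) Q x).
Proof.
move=> Q0.
have -> : absz (\sum_(x | P x) chi S x)%R = absz (\sum_(x | P (antipode x)) chi S x)%R.
  have -> : (\sum_(x | P x) chi S x = (-1) ^+ odd #|S| * \sum_(x | P (antipode x)) chi S x)%R.
    rewrite mulr_sumr (reindex_inj (inv_inj (@antipodeK d))) /=.
    by apply: eq_bigr => x _; rewrite /chi parity_antipode signr_addb.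
  by rewrite abszMsign.
have -> : (\sum_(x | P (antipode x)) chi S x = \sum_x
    ((if P (antipode x) then chi S x else 0) - (if Q x then chi S x else 0)))%R.
  by rewrite sumrB -!big_mkcond Q0 subr0.
elim/big_ind2: _ => // [a m b n am bn | x _].
  lia.
by case: (P _) (Q x) => [] []; rewrite ?subrr ?subr0 ?sub0r ?abszN // /chi;
  case: (parity S x).
Qed.

(* [A] is the set of starless words.  The antipodal image of [A] and the union [C] of the faces
   with at least [t] stars differ in at most as many points as the weight falls short of its
   maximum, and [chi S] sums to 0 on [C]. *)
Lemma weight_bound d (t : nat) (I : finType) (w : I -> word d) :
  t \in [:: 2; 3] -> t <= d ->
  (forall a b, a != b -> 0 < wdist (w a) (w b) /\ wdist (w a) (w b) + t <= d) ->
  exists A : {set vertex d},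
    {in A &, forall x y, hdist x y + t <= d} /\
    forall S : {set 'I_d}, d < #|S| + t ->
      2 * (2 ^ t * #|I| + absz (\sum_(x in A) chi S x)%R) <=
        (2 ^ t.-1 + 2) * 2 ^ d + 2 * ((2 ^ t.-1).-1 * #|A|).
Proof.
move=> t23 td wd.
pose s a := #|stars (w a)|.
pose cov x := [pick a | x \in face (w a)].
have covP x a : x \in face (w a) -> cov x = Some a.
  move=> xa; rewrite /cov; case: pickP => [b xb | /(_ a)]; last by rewrite xa.
  congr Some; apply: contraTeq isT => /wd[]; by rewrite (face_wdist0 xb xa).
have covK x a : cov x = Some a -> x \in face (w a).
  by rewrite /cov; case: pickP => // b xb [<-].
pose lv x := omap s (cov x).
have lvP x n : lv x = Some n -> exists2 a, x \in face (w a) & s a = n.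
  by rewrite /lv; case E: (cov x) => [a|] //= [<-]; exists a => //; apply: covK.
(* Faces are disjoint, so summing over words and their faces is summing over vertices; it is needed
   in [nat] for weights and in [int] for characters. *)
have sum_cov (R : Type) (idx : R) (op : Monoid.com_law idx) (g : nat -> vertex d -> R) :
    \big[op/idx]_a \big[op/idx]_(x in face (w a)) g (s a) x
    = \big[op/idx]_x oapp (g^~ x) idx (lv x).
  rewrite (exchange_big_dep predT) //=; apply: eq_bigr => x _.
  rewrite /lv; case E: (cov x) => [a|] /=.
    rewrite (big_pred1 a) // => b; apply/idP/eqP => [/covP|->]; last exact: covK.
    by rewrite E => -[].
  by rewrite big_pred0 // => b; apply/negP => /covP; rewrite E.
pose isA x := oapp (eq_op 0) false (lv x).
pose isC x := oapp (leq t) false (lv x).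
have pairP x n m : lv x = Some n -> lv (antipode x) = Some m -> t <= n + m.
  move=> /lvP[a xa <-] /lvP[b xb <-]; have := face_antipode xa xb; rewrite -/(s a) -/(s b).
  have [<- | ab] := eqVneq a b.
    have -> : wdist (w a) (w a) = 0 by exact: (face_wdist0 xa xa).
    exact: leq_trans.
  by have [] := wd a b ab; lia.
(* A face with [s] stars contributes [2 ^ s * 2 ^ (t - s)], which is at least [2 ^ t] since the
   subtraction truncates. *)
have weight : 2 ^ t * #|I| <= \sum_x oapp (fun n => 2 ^ (t - n)) 0 (lv x).
  have := sum_cov _ _ addn (fun n _ => 2 ^ (t - n)); rewrite /= => <-.
  rewrite mulnC -sum_nat_const; apply: leq_sum => a _.
  by rewrite sum_nat_const card_face -expnD leq_pexp2l // -/(s a); lia.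
exists [set x | isA x]; split.
  have starsA x : x \in [set x | isA x] -> exists2 a, x \in face (w a) & stars (w a) = set0.
    rewrite inE /isA; case E: (lv x) => [n|] //= /eqP n0; have [a xa sa] := lvP x n E.
    by exists a => //; apply/eqP; rewrite -cards_eq0 -/(s a) sa -n0.
  move=> x y /starsA[a xa a0] /starsA[b yb b0]; rewrite (hdist_face a0 b0 xa yb).
  have [<- | ab] := eqVneq a b; last by have [] := wd a b ab.
  by rewrite -(hdist_face a0 a0 xa xa) hdistE big1 // => i _; rewrite eqxx.
move=> S dS.
have chiC : (\sum_(x | isC x) chi S x = 0)%R.
  rewrite big_mkcond; transitivity
      (\sum_x oapp (fun n => if (t <= n)%N then chi S x else 0) 0 (lv x))%R.
    by apply: eq_bigr => x _; rewrite /isC; case: (lv x).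
  have := sum_cov _ _ +%R (fun n x => if (t <= n)%N then chi S x else 0%R); rewrite /= => <-.
  apply: big1 => a _; case: leqP => [ta | _]; last by rewrite big1.
  apply: sum_chi_face; rewrite -card_gt0.
  (* The sizes of [S] and the star set add up to more than [d], so the two meet. *)
  by have := cardsUI S (stars (w a)); have := max_card (S :|: stars (w a));
    rewrite card_ord -/(s a); lia.
have := absz_sum_chi isA chiC.
have -> : (\sum_(x | isA x) chi S x = \sum_(x in [set x | isA x]) chi S x)%R.
  by apply: eq_bigl => x; rewrite inE.
have cA : #|[set x | isA x]| = \sum_x isA x.
  by rewrite -sum1_card big_mkcond; apply: eq_bigr => x _; rewrite inE; case: (isA x).
set X := absz _ => leX; rewrite cA.
(* Summing over all [x] counts each antipodal pair twice, whence the factor 2 in the bound. *)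
have : \sum_x (oapp (fun n => 2 ^ (t - n)) 0 (lv x) +
      oapp (fun n => 2 ^ (t - n)) 0 (lv (antipode x)) +
      ((isA (antipode x) (+) isC x) + (isA x (+) isC (antipode x)))) <=
    \sum_(x : vertex d) ((2 ^ t.-1 + 2) + (2 ^ t.-1).-1 * (isA x + isA (antipode x))).
  by apply: leq_sum => x _; apply: weight_pair => // n m; apply: pairP.
rewrite !big_split /= -big_distrr big_split /= !sum_nat_const card_ffun card_bool card_ord.
rewrite (sum_antipode (fun x => oapp (fun n => 2 ^ (t - n)) 0 (lv x))) (sum_antipode isA).
have -> : \sum_x (isA x (+) isC (antipode x)) = \sum_x (isA (antipode x) (+) isC x).
  rewrite -(sum_antipode (fun x => isA (antipode x) (+) isC x)).
  by apply: eq_bigr => x _; rewrite antipodeK.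
move: weight leX; set W := \sum_x oapp _ _ _; set D := \sum_x nat_of_bool (_ (+) _).
set a := \sum_x nat_of_bool (isA x); rewrite mulnDl !mulnDr (mulnC (2 ^ d)) (mulnC (2 ^ d)).
set P := 2 ^ t.-1 * _; set Q := 2 * 2 ^ d; set K := _ * a; set M := 2 ^ t * _.
by clearbody W D a P Q K M; lia.
Qed.

Lemma Posz_card d (B : {set vertex d}) : Posz #|B| = (\sum_x (if x \in B then 1 else 0))%R.
Proof.
rewrite -sum1_card (big_morph Posz PoszD (erefl _)) big_mkcond.
by apply: eq_bigr => x _; case: ifP.
Qed.

Lemma sum_chi_setT d (A : {set vertex d}) :
  (\sum_(x in A) chi setT x = Posz #|parity_class A false| - Posz #|parity_class A true|)%R.
Proof.
rewrite !Posz_card -sumrB big_mkcond; apply: eq_bigr => x _.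
by rewrite !inE /chi; case: (x \in A); case: (parity setT x).
Qed.

Lemma sum_chi_setC1 d (A : {set vertex d}) i :
  (\sum_(x in A) chi [set~ i] x =
     Posz #|half (parity_class A false) i false| - Posz #|half (parity_class A false) i true|
     - (Posz #|half (parity_class A true) i false| - Posz #|half (parity_class A true) i true|))%R.
Proof.
rewrite !Posz_card -!sumrB big_mkcond; apply: eq_bigr => x _.
rewrite !inE /chi (parityT_setC1 i x).
by case: (x \in A); case: (x i); case: (parity [set~ i] x).
Qed.

(** * Upper bounds for the three word families *)

Lemma code_bound8 (I : finType) (w : I -> word 8) :
  (forall a b, a != b -> 1 <= wdist (w a) (w b) <= 6) -> #|I| <= 150.
Proof.
move=> wd; have [//|//|a b /wd|A [Adist bound]] := @weight_bound 8 2 I w; first by lia.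
have := bound setT; rewrite cardsT card_ord sum_chi_setT (parity_class_split A) => /(_ isT).
rewrite (_ : 2 ^ 2 = 4) // (_ : 2 ^ 8 = 256) //=.
(* With class sizes [e] and [o] the bound reads [4 * #|I| <= 512 + 2 * minn e o], at most 602,
   whereas 151 words need 604. *)
have := anticode8 Adist.
by move: #|parity_class A false| #|parity_class A true| => e o; case; lia.
Qed.

Lemma code_bound7 (I : finType) (w : I -> word 7) :
  (forall a b, a != b -> 1 <= wdist (w a) (w b) <= 5) -> #|I| <= 74.
Proof.
move=> wd; have [//|//|a b /wd|A [Adist bound]] := @weight_bound 7 2 I w; first by lia.
have := bound setT; rewrite cardsT card_ord => /(_ isT).
rewrite (_ : 2 ^ 2 = 4) // (_ : 2 ^ 7 = 128) //= => boundT.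
have [//|I75] := leqP #|I| 74.
have A44 : 44 <= #|A|.
  by move: boundT I75; move: (absz _) #|A| #|I| => X a n; lia.
have [E22 O22 [i neq]] := anticode7 Adist A44.
(* As [4 * 75 = 256 + 44], no imbalance can be afforded, but this character sums to twice the
   nonzero difference of the two half sizes. *)
have := bound [set~ i]; rewrite cardsC1 card_ord sum_chi_setC1 => /(_ isT).
rewrite (_ : 2 ^ 2 = 4) // (_ : 2 ^ 7 = 128) //=.
rewrite (parity_class_split A) E22 O22.
have := half_split (parity_class A false) i; have := half_split (parity_class A true) i.
rewrite E22 O22; move: neq I75; move: #|I| => n.
move: #|half (parity_class A false) i false| #|half (parity_class A false) i true|.
move: #|half (parity_class A true) i false| #|half (parity_class A true) i true|.
by move=> o0 o1 e0 e1; lia.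
Qed.

Lemma code_bound6 (I : finType) (w : I -> word 6) :
  (forall a b, a != b -> 1 <= wdist (w a) (w b) <= 3) -> #|I| <= 27.
Proof.
move=> wd; have [//|//|a b /wd|A [Adist bound]] := @weight_bound 6 3 I w; first by lia.
have := bound setT; rewrite cardsT card_ord => /(_ isT).
rewrite (_ : 2 ^ 3 = 8) // (_ : 2 ^ 6 = 64) //= => boundT.
have [//|I28] := leqP #|I| 27.
have A11 : 11 <= #|A|.
  by move: boundT I28; move: (absz _) #|A| #|I| => X a n; lia.
have [E56 O56 [i [b [Ei Oi]]]] := anticode6 Adist A11.
(* The opposite leanings add up to an imbalance of at least [#|A| - 4], while 28 words leave only
   [3 * #|A| - 32], which is smaller for [#|A| <= 12]. *)
have := bound [set~ i]; rewrite cardsC1 card_ord sum_chi_setC1 => /(_ isT).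
rewrite (_ : 2 ^ 3 = 8) // (_ : 2 ^ 6 = 64) //=.
rewrite (parity_class_split A).
have := half_split (parity_class A false) i; have := half_split (parity_class A true) i.
move: E56 O56 Ei Oi I28; move: #|parity_class A false| #|parity_class A true| #|I| => e o n.
case: b => /=.
  move: #|half (parity_class A false) i false| #|half (parity_class A false) i true|.
  move: #|half (parity_class A true) i false| #|half (parity_class A true) i true|.
  by move=> o0 o1 e0 e1; lia.
move: #|half (parity_class A false) i false| #|half (parity_class A false) i true|.
move: #|half (parity_class A true) i false| #|half (parity_class A true) i true|.
by move=> o0 o1 e0 e1; lia.
Qed.

(** * Extremal families *)

(** Words as plain lists, so that the extremal families can be checked by evaluation. *)
Definition pattern := seq (option bool).

Definition pattern_dist d (u v : pattern) : nat :=
  count (fun i => conflict (nth None u i) (nth None v i)) (iota 0 d).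

Definition word_of_pattern d (u : pattern) : word d := [ffun i : 'I_d => nth None u i].

Lemma wdist_pattern d u v :
  wdist (word_of_pattern d u) (word_of_pattern d v) = pattern_dist d u v.
Proof.
have iotaE : iota 0 d = index_iota 0 d by rewrite /index_iota subn0.
rewrite /pattern_dist -sum1_count iotaE big_mkcond big_mkord /wdist -sum1_card big_mkcond /=.
by apply: eq_bigr => i _; rewrite inE !ffunE.
Qed.

Lemma wdistC d (u v : word d) : wdist u v = wdist v u.
Proof.
by apply: eq_card => i; rewrite !inE; case: (u i) (v i) => [[]|] [[]|].
Qed.

Lemma pattern_code k d n (L : seq pattern) : size L = n ->
  pairwise (fun u v => 1 <= pattern_dist d u v <= k) L ->
  exists w : 'I_n -> word d, forall a b, a != b -> 1 <= wdist (w a) (w b) <= k.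
Proof.
move=> <- /(pairwiseP [::]) codeL; exists (fun a => word_of_pattern d (nth [::] L a)) => a b.
rewrite neq_ltn => /orP[ab | ba]; last rewrite wdistC; rewrite wdist_pattern;
  by apply: codeL; rewrite // !inE.
Qed.

Fixpoint cube n : seq (seq bool) :=
  if n is m.+1 then map (cons false) (cube m) ++ map (cons true) (cube m) else [:: [::]].

(* The low layers of the cube are covered by vertices, the antipodal high ones by 2-faces in the
   last two directions, and the 2-faces of the middle layer by two parallel edges each, in
   perpendicular directions for antipodal 2-faces. *)
Definition layered_patterns n (wt : seq bool -> nat) c : seq pattern :=
  flatten [seq let p := map Some y in
    if wt y < c then [seq p ++ map Some z | z <- cube 2]
    else if c < wt y then [:: p ++ [:: None; None]]
    else if head false y then [:: p ++ [:: Some false; None]; p ++ [:: Some true; None]]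
    else [:: p ++ [:: None; Some false]; p ++ [:: None; Some true]]
  | y <- cube n].

(** The count is [22 * 4 + 20 * 2 + 22 = 150]. *)
Definition patterns8 := layered_patterns 6 (count id) 3.

(** The 5-cube has no middle layer, so the weight ignores one coordinate; the count is
    [10 * 4 + 12 * 2 + 10 = 74]. *)
Definition patterns7 := layered_patterns 5 (fun y => count id (behead y)) 2.

(* Fibres over the 3-cube: vertices over 0, one 3-face over its antipode, four edges in direction
   [j] over the unit vector [j], and two 2-faces perpendicular to [j] over its antipode. *)
Definition patterns6 : seq pattern :=
  flatten [seq let p := map Some y in
    match count id y with
    | 0 => [seq p ++ map Some z | z <- cube 3]
    | 1 => let j := index true y in
           [seq p ++ map Some (take j z) ++ None :: map Some (drop j z) | z <- cube 2]
    | 2 => let j := index false y in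
           [seq p ++ set_nth None [:: None; None; None] j (Some b) | b <- [:: false; true]]
    | _ => [:: p ++ [:: None; None; None]]
    end
  | y <- cube 3].

From mathcomp Require Import classical_sets cardinality.
From mathcomp Require Import set_interval reals.
Local Open Scope classical_set_scope.
Local Open Scope card_scope.
Local Open Scope ring_scope.

(** * Boxes and words *)

Definition box (R : realType) d (lo hi : 'I_d -> R) : set 'rV[R]_d :=
  [set x | forall i, lo i <= x ord0 i <= hi i].

Lemma standard_boxP (R : realType) d (K : set 'rV[R]_d) : standard_box K ->
  exists lohi : ('I_d -> R) * ('I_d -> R),
    (forall i, lohi.1 i <= lohi.2 i) /\ K = box lohi.1 lohi.2.
Proof.
case=> I [/choice[lo /choice[hi /all_and2[lohi II]]] ->]; exists (lo, hi); split=> //=.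
by apply/seteqP; split=> x xK i; move: (xK i); rewrite II /= in_itv.
Qed.

Lemma box_standard (R : realType) d (lo hi : 'I_d -> R) :
  (forall i, lo i <= hi i) -> standard_box (box lo hi).
Proof.
move=> lohi; exists (fun i => `[lo i, hi i]%classic); split.
  by move=> i; exists (lo i), (hi i).
by apply/seteqP; split=> x xK i; move: (xK i); rewrite /= in_itv.
Qed.

Lemma boxI (R : realType) d (lo hi lo' hi' : 'I_d -> R) :
  box lo hi `&` box lo' hi' =
  box (fun i => Num.max (lo i) (lo' i)) (fun i => Num.min (hi i) (hi' i)).
Proof.
apply/seteqP; split=> x /=.
  by move=> [xK xK'] i; rewrite ge_max le_min; move: (xK i) (xK' i) => /andP[-> ->] /andP[-> ->].
move=> xK; split=> i; move: (xK i); rewrite ge_max le_min => /andP[/andP[? ?] /andP[? ?]];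
  exact/andP.
Qed.

(** The spans for [T] and its complement generate the whole space, and neither dimension exceeds the
    number of generators. *)
Lemma dim_span_delta (R : realType) d (T : {set 'I_d}) :
  \dim <<[seq (delta_mx ord0 i : 'rV[R]_d) | i <- enum T]>> = #|T|.
Proof.
pose U (T : {set 'I_d}) := <<[seq (delta_mx ord0 i : 'rV[R]_d) | i <- enum T]>>%VS.
have dim_le (S : {set 'I_d}) : (\dim (U S) <= #|S|)%N.
  by apply: leq_trans (dim_span _) _; rewrite size_map -cardE.
apply/eqP; rewrite eqn_leq dim_le /=.
have : (fullv <= U T + U (~: T))%VS.
  apply/subvP => x _; rewrite (row_sum_delta x); apply: memv_suml => i _; apply: memvZ.
  case: (boolP (i \in T)) => iT.
    by apply/(subvP (addvSl _ _))/memv_span/map_f; rewrite mem_enum.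
  by apply/(subvP (addvSr _ _))/memv_span/map_f; rewrite mem_enum inE.
move/dimvS; rewrite dimvf dim_matrix mul1r => d_le.
have := leq_trans d_le (leq_trans (dimv_add_leqif _ _).1 (leq_add (leqnn _) (dim_le (~: T)))).
by rewrite -{1}(card_ord d) -(cardsC T) leq_add2r.
Qed.

Lemma affine_dim_box (R : realType) d (lo hi : 'I_d -> R) m :
  (forall i, lo i <= hi i) ->
  affine_dim (box lo hi) m <-> m = #|[set i | lo i < hi i]%SET|.
Proof.
move=> lohi; set T := [set i | _]%SET.
pose U := <<[seq (delta_mx ord0 i : 'rV[R]_d) | i <- enum T]>>%VS.
have inU x y : box lo hi x -> box lo hi y -> y - x \in U.
  move=> xK yK; rewrite (row_sum_delta (y - x)); apply: memv_suml => i _.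
  case: (boolP (i \in T)) => iT.
    by apply/memvZ/memv_span/map_f; rewrite mem_enum.
  have eq_lohi : lo i = hi i.
    by apply/eqP; move: iT; rewrite inE lt_neqAle lohi andbT negbK.
  have -> : (y - x) 0 i = 0.
    have /andP[x1 x2] := xK i; have /andP[y1 y2] := yK i.
    rewrite !mxE; apply/eqP; rewrite subr_eq0; apply/eqP/le_anti.
    by rewrite (le_trans y2) -?eq_lohi //= (le_trans x2) // -eq_lohi.
  by rewrite scale0r mem0v.
have leU x (V : {vspace 'rV[R]_d}) : box lo hi x ->
    (forall y, box lo hi y -> y - x \in V) -> (U <= V)%VS.
  move=> xK yV; apply/span_subvP => _ /mapP[i /[!mem_enum] /[!inE] iT ->].
  (* Moving coordinate [i] of [x] to [c] stays in the box. On a nondegenerate side one of the two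
     endpoints can serve as [c]. *)
  have step c : lo i <= c <= hi i -> c != x ord0 i -> delta_mx ord0 i \in V.
    move=> cK cx; have c0 : c - x ord0 i != 0 by rewrite subr_eq0.
    have <- : (c - x ord0 i)^-1 *: ((c - x ord0 i) *: delta_mx ord0 i)
        = delta_mx ord0 i :> 'rV[R]_d.
      by rewrite scalerA mulVf // scale1r.
    apply: memvZ; pose y := x + (c - x ord0 i) *: delta_mx ord0 i : 'rV[R]_d.
    have -> : (c - x ord0 i) *: delta_mx ord0 i = y - x by rewrite /y [x + _]addrC addrK.
    apply: yV => j; rewrite !mxE /=; have [-> | ji] := eqVneq j i.
      by rewrite mulr1 addrC subrK.
    by rewrite mulr0 addr0.
  have [xlo | xlo] := eqVneq (lo i) (x ord0 i); last by apply: step xlo; rewrite lexx lohi.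
  by apply: (step (hi i)); rewrite ?lexx ?lohi // -xlo gt_eqF.
split=> [[x [xK [V [<- xV leV]]]] | ->].
  have -> : V = U; last exact: dim_span_delta.
  by apply/eqP; rewrite eqEsubv (leU x) // andbT; apply: leV => y; apply: inU.
have loK : box lo hi (\row_i lo i) by move=> i; rewrite mxE lexx lohi.
exists (\row_i lo i); split=> //; exists U; split; first exact: dim_span_delta.
  by move=> y; apply: inU.
by move=> V; apply: leU.
Qed.

Lemma neighborly_word (R : realType) k d n (F : set (set 'rV[R]_d)) :
  (0 < d)%N -> neighborly k F -> F #= `I_n ->
  exists w : 'I_n -> word d, forall a b, a != b -> (1 <= wdist (w a) (w b) <= k)%N.
Proof.
move=> d0 [_ Fbox Fdim]; rewrite card_eq_sym => /card_set_bijP[f [fF finj _]].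
have fFa (a : 'I_n) : F (f a) by apply: fF => /=.
have /choice[lohi lohiP] (a : 'I_n) := standard_boxP (Fbox _ (fFa a)).1.
pose lo a := (lohi a).1; pose hi a := (lohi a).2.
have fE (a : 'I_n) : f a = box (lo a) (hi a) by exact: (lohiP a).2.
have le_lohi a i : lo a i <= hi a i by exact: (lohiP a).1.
have lt_lohi a i : lo a i < hi a i.
  have := (Fbox _ (fFa a)).2; rewrite fE => /(affine_dim_box _ (le_lohi a)) dT.
  have /setP/(_ i) : [set i | lo a i < hi a i]%SET = [set: 'I_d]%SET.
    by apply/eqP; rewrite eqEcard finset.subsetT /= cardsT card_ord -dT.
  by rewrite !inE.
have inj_f (a b : 'I_n) : a != b -> f a <> f b.
  by move=> ab /finj; rewrite !inE /= => /(_ (ltn_ord a) (ltn_ord b)) /val_inj /eqP; apply/negP.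
have meet (a b : 'I_n) : a != b -> exists2 m, (d - k <= m <= d - 1)%N & affine_dim (f a `&` f b) m.
  by move=> ab; apply: Fdim => //; apply: inj_f.
(* Since the boxes meet pairwise, in each coordinate every lower end is below every upper end; hence
   all contacts in that coordinate happen at one value. *)
have le_cross a b i : lo a i <= hi b i.
  have [<- // | /meet[m _ [x []]]] := eqVneq a b.
  by rewrite !fE => -[/(_ i)/andP[lox _] /(_ i)/andP[_ xhi]] _; apply: le_trans xhi.
(* The letter records whether the box touches the contact value with its upper end, with its lower
   end, or not at all. *)
pose w a : word d := [ffun i =>
  if [exists b, hi a i == lo b i] then Some true
  else if [exists b, lo a i == hi b i] then Some false else None].
have wT a b i : hi a i = lo b i -> w a i = Some true.
  by move=> ab; rewrite ffunE; case: existsP => // -[]; exists b; rewrite ab.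
have wF a b i : lo a i = hi b i -> w a i = Some false.
  move=> ab; rewrite ffunE; case: existsP => [[c /eqP ac] | _].
    by have := le_cross c b i; rewrite -ac -ab leNgt lt_lohi.
  by case: existsP => // -[]; exists b; rewrite ab.
have wTP a i : w a i = Some true -> exists b, hi a i = lo b i.
  by rewrite ffunE; case: existsP => [[b /eqP] | _]; [exists b | case: existsP].
have wFP a i : w a i = Some false -> exists b, lo a i = hi b i.
  by rewrite ffunE; case: existsP => // _; case: existsP => // -[b /eqP]; exists b.
have TF a b i : w a i = Some true -> w b i = Some false -> hi a i = lo b i.
  move=> /wTP[c ac] /wFP[e be]; apply/le_anti; rewrite le_cross andbT.
  by rewrite ac be le_cross.
have confP a b i : conflict (w a i) (w b i) = (hi a i == lo b i) || (hi b i == lo a i).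
  apply/idP/orP => [| [] /eqP ab]; last 2 first.
  - by rewrite (wT a b i ab) (wF b a i (esym ab)).
  - by rewrite (wT b a i ab) (wF a b i (esym ab)).
  case wa: (w a i) => [[]|]; case wb: (w b i) => [[]|] //= _.
    by left; apply/eqP/TF.
  by right; apply/eqP/TF.
exists w => a b ab; have [m md] := meet a b ab; rewrite !fE boxI.
have le_meet i : Num.max (lo a i) (lo b i) <= Num.min (hi a i) (hi b i).
  by rewrite ge_max !le_min !le_lohi !le_cross.
move/(affine_dim_box _ le_meet).
have -> : [set i | Num.max (lo a i) (lo b i) < Num.min (hi a i) (hi b i)]%SET
    = (~: [set i | conflict (w a i) (w b i)])%SET.
  apply/setP=> i; rewrite !inE confP gt_max !lt_min !lt_lohi /= andbT negb_or.
  by rewrite !lt_neqAle !le_cross !andbT eq_sym [hi a i == _]eq_sym [lo b i == _]eq_sym andbC.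
have := cardsC [set i | conflict (w a i) (w b i)]%SET; rewrite card_ord -/(wdist _ _); lia.
Qed.

(** The letters 0, 1 and star become the sides [[0, 1]], [[-1, 0]] and [[-1, 1]]; only the first two
    meet in a single point. *)
Lemma word_neighborly (R : realType) k d n (w : 'I_n -> word d) : (k <= d)%N ->
  (forall a b, a != b -> (1 <= wdist (w a) (w b) <= k)%N) ->
  exists2 F : set (set 'rV[R]_d), neighborly k F & F #= `I_n.
Proof.
move=> kd wd.
have ltN11 : -1 < 1 :> R by apply: lt_trans ltr01; rewrite ltrN10.
pose lo a i : R := if w a i == Some false then 0 else -1.
pose hi a i : R := if w a i == Some true then 0 else 1.
have le_lohi a i : lo a i <= hi a i.
  by rewrite /lo /hi; case: (w a i) => [[]|] /=; rewrite ?ler01 ?lerN10 // ltW.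
have meet_le a b i : Num.max (lo a i) (lo b i) <= Num.min (hi a i) (hi b i).
  rewrite ge_max !le_min /lo /hi.
  by case: (w a i) (w b i) => [[]|] [[]|] /=; rewrite ?lexx ?ler01 ?lerN10 ?(ltW ltN11).
have meet_lt a b i :
    (Num.max (lo a i) (lo b i) < Num.min (hi a i) (hi b i)) = ~~ conflict (w a i) (w b i).
  rewrite gt_max !lt_min /lo /hi.
  by case: (w a i) (w b i) => [[]|] [[]|] /=; rewrite ?ltxx ?ltr01 ?ltrN10 ?ltN11.
pose K a := box (lo a) (hi a).
have dimI a b m : affine_dim (K a `&` K b) m <-> m = (d - wdist (w a) (w b))%N.
  rewrite /K boxI affine_dim_box; last exact: meet_le.
  suff -> : #|[set i | Num.max (lo a i) (lo b i) < Num.min (hi a i) (hi b i)]%SET|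
      = (d - wdist (w a) (w b))%N by [].
  rewrite /wdist -[X in (X - _)%N](card_ord d) -cardsT -cardsDS ?finset.subsetT //.
  by apply: eq_card => i; rewrite !inE meet_lt andbT.
have wdist0 a : wdist (w a) (w a) = 0%N.
  apply/eqP; rewrite cards_eq0; apply/eqP/setP=> i.
  by rewrite !inE; case: (w a i) => [[]|].
have dimK a : affine_dim (K a) d.
  by rewrite -[K a]setIid dimI wdist0 subn0.
have injK : {in setT &, injective K}.
  move=> a b _ _ Kab; apply/eqP/negPn/negP => ab; have := dimK a.
  rewrite -[K a]setIid {2}Kab dimI; have := wd a b ab; lia.
have cF : range K #= `I_n by apply: card_eq_trans (inj_card_eq injK) (card_esym card_II).
exists (range K) => //; split.
- by apply/finite_setP; exists n.
- by move=> _ [a _ <-]; split; [apply: box_standard | apply: dimK].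
move=> _ _ [a _ <-] [b _ <-] Kab.
have ab : a != b by apply/eqP => ab; apply: Kab; rewrite ab.
by exists (d - wdist (w a) (w b))%N; [have := wd a b ab; lia | apply/dimI].
Qed.

Lemma neighborly_numberP (R : realType) k d N : (0 < k <= d)%N ->
  (exists w : 'I_N -> word d, forall a b, a != b -> (1 <= wdist (w a) (w b) <= k)%N) ->
  (forall n (w : 'I_n -> word d),
    (forall a b, a != b -> (1 <= wdist (w a) (w b) <= k)%N) -> (n <= N)%N) ->
  neighborly_number R k d N.
Proof.
move=> /andP[k0 kd] [w wd] bound; split; first exact: word_neighborly wd.
by move=> F n Fk /(neighborly_word (leq_trans k0 kd) Fk)[v /bound].
Qed.

Theorem theorem1p8 (R : realType) :
  neighborly_number R 3 6 27 /\
  neighborly_number R 5 7 74 /\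
  neighborly_number R 6 8 150.
Proof.
split; [|split].
- apply: neighborly_numberP => // [|n w /code_bound6]; last by rewrite card_ord.
  by apply: (@pattern_code _ _ _ patterns6); vm_compute.
- apply: neighborly_numberP => // [|n w /code_bound7]; last by rewrite card_ord.
  by apply: (@pattern_code _ _ _ patterns7); vm_compute.
apply: neighborly_numberP => // [|n w /code_bound8]; last by rewrite card_ord.
by apply: (@pattern_code _ _ _ patterns8); vm_compute.
Qed.
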